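(* Let $u:A\to B$ be a finite ring morphism (i.e. $B$ is a finitely generated $A$-module via $u$) that is a strong PSI-morphism. Then $u$ is surjective.
   Context: All rings are commutative and unitary, and ring morphisms are unitary. For $P\in\mathrm{Spec}(A)$, $k_A(P)=A_P/PA_P$ denotes the residue field of $A$ at $P$. A ring morphism $u:A\to B$ is a strong PSI-morphism if for every $P\in\mathrm{Spec}(A)$ with $k_A(P)\otimes_A B\neq 0$, the canonical map $k_A(P)\to k_A(P)\otimes_A B$ is an isomorphism. *)

(* Defs.v *)
From HB Require Import structures.
From mathcomp Require Import all_boot all_algebra.
From mathcomp Require Import boolp classical_sets.
From mathcomp Require Import ring.

Set Implicit Arguments.
Unset Strict Implicit.
Unset Printing Implicit Defensive.

Import GRing.Theory.
Local Open Scope ring_scope.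
Local Open Scope quotient_scope.

(* Rings are [comPzRingType]s, so the zero ring is allowed; ideals are
   [Prop]-valued sets. *)

Definition prime_ideal (A : comPzRingType) (P : set A) : Prop :=
  [/\ [/\ P 0, forall x y, P x -> P y -> P (x + y) & forall a x, P x -> P (a * x)],
      ~ P 1 & forall x y, P (x * y) -> P x \/ P y].

Record spec (A : comPzRingType) := Spec {
  spec_set :> A -> Prop;
  spec_prime : prime_ideal spec_set
}.

Section SpecTheory.
Variables (A : comPzRingType) (P : spec A).

Lemma spec0 : P 0. Proof. by case: (spec_prime P) => -[]. Qed.
Lemma specD x y : P x -> P y -> P (x + y).
Proof. by case: (spec_prime P) => -[_ h _] _ _; apply: h. Qed.
Lemma specMl a x : P x -> P (a * x).
Proof. by case: (spec_prime P) => -[_ _ h] _ _; apply: h. Qed.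
Lemma spec1 : ~ P 1. Proof. by case: (spec_prime P). Qed.
Lemma specM x y : P (x * y) -> P x \/ P y.
Proof. by case: (spec_prime P) => _ _; apply. Qed.

End SpecTheory.

(* [localization P] is A_P: fractions a / s with s outside P, where
   a / s = b / t iff r * (a * t - b * s) = 0 for some r outside P. *)
Section Localization.
Variables (A : comPzRingType) (P : spec A).

Record denom := MkDenom {
  dval :> A;
  dvalP : dval \notin (spec_set P : set A)
}.
HB.instance Definition _ := [isSub for dval].
HB.instance Definition _ := [Choice of denom by <:].

Lemma denom_subproof (s : A) : ~ P s -> s \notin (spec_set P : set A).
Proof. by move=> h; rewrite notin_setE. Qed.
Definition Denom (s : A) (h : ~ P s) : denom := MkDenom (denom_subproof h).

Lemma denomP (s : denom) : ~ P (dval s).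
Proof. by rewrite -notin_setE; exact: dvalP. Qed.

Definition denom1 : denom := Denom (@spec1 A P).

Lemma denom_mul_subproof (s t : denom) : ~ P (dval s * dval t).
Proof. by case/specM; apply: denomP. Qed.
Definition denomM (s t : denom) : denom := Denom (@denom_mul_subproof s t).

Definition loc_equiv (x y : A * denom) : bool :=
  `[< exists r : denom, dval r * (x.1 * dval y.2 - y.1 * dval x.2) = 0 >].

Lemma loc_equivP x y : reflect
  (exists r : denom, dval r * (x.1 * dval y.2 - y.1 * dval x.2) = 0)
  (loc_equiv x y).
Proof. exact: asboolP. Qed.

Lemma loc_equiv_is_equiv : equiv_class_of loc_equiv.
Proof.
have sym x y : loc_equiv x y -> loc_equiv y x.
  move=> /loc_equivP[r hr]; apply/loc_equivP; exists r.
  by rewrite -opprB mulrN hr oppr0.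
split=> [x|x y|y x z].
- by apply/loc_equivP; exists denom1; rewrite subrr mulr0.
- by apply/idP/idP; apply: sym.
move=> /loc_equivP[r hr] /loc_equivP[t ht]; apply/loc_equivP.
exists (denomM (denomM r t) y.2) => /=.
transitivity (dval t * dval z.2 * (dval r * (x.1 * dval y.2 - y.1 * dval x.2))
  + dval r * dval x.2 * (dval t * (y.1 * dval z.2 - z.1 * dval y.2))); first by ring.
by rewrite hr ht !mulr0 addr0.
Qed.

Canonical loc_equiv_equiv := EquivRelPack loc_equiv_is_equiv.
Canonical loc_equiv_encModRel := defaultEncModRel loc_equiv.

Definition localization := {eq_quot loc_equiv}.
HB.instance Definition _ := EqQuotient.on localization.
HB.instance Definition _ := Choice.on localization.

Definition loc_frac (a : A) (s : denom) : localization := \pi_localization (a, s).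

Lemma loc_fracP a s b t :
  (loc_frac a s = loc_frac b t) <->
  (exists r : denom, dval r * (a * dval t - b * dval s) = 0).
Proof.
split; first by move/eqmodP/loc_equivP.
by move=> h; apply/eqmodP/loc_equivP.
Qed.

Lemma loc_fracW (x : localization) : exists a s, x = loc_frac a s.
Proof. by exists (repr x).1, (repr x).2; rewrite /loc_frac -surjective_pairing reprK. Qed.

Definition loc_add (x y : localization) : localization :=
  loc_frac ((repr x).1 * dval (repr y).2 + (repr y).1 * dval (repr x).2)
           (denomM (repr x).2 (repr y).2).
Definition loc_opp (x : localization) : localization :=
  loc_frac (- (repr x).1) (repr x).2.
Definition loc_mul (x y : localization) : localization :=
  loc_frac ((repr x).1 * (repr y).1) (denomM (repr x).2 (repr y).2).

Lemma loc_repr a s : exists r : denom,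
  dval r * ((repr (loc_frac a s)).1 * dval s - a * dval (repr (loc_frac a s)).2) = 0.
Proof. by apply/loc_fracP; rewrite /loc_frac -surjective_pairing reprK. Qed.

Lemma loc_addE a s b t :
  loc_add (loc_frac a s) (loc_frac b t) =
  loc_frac (a * dval t + b * dval s) (denomM s t).
Proof.
rewrite /loc_add; case: (loc_repr a s) => r; case: (loc_repr b t) => r'.
case: (repr (loc_frac a s)) (repr (loc_frac b t)) => [a' s'] [b' t'] /= h' h.
apply/loc_fracP; exists (denomM r r') => /=.
transitivity (dval r' * dval t * dval t' * (dval r * (a' * dval s - a * dval s')) +
   dval r * dval s * dval s' * (dval r' * (b' * dval t - b * dval t'))); first by ring.
by rewrite h h' !mulr0 addr0.
Qed.

Lemma loc_oppE a s : loc_opp (loc_frac a s) = loc_frac (- a) s.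
Proof.
rewrite /loc_opp; case: (loc_repr a s) => r.
case: (repr (loc_frac a s)) => [a' s'] /= h; apply/loc_fracP; exists r.
by rewrite !mulNr -opprD mulrN h oppr0.
Qed.

Lemma loc_mulE a s b t :
  loc_mul (loc_frac a s) (loc_frac b t) = loc_frac (a * b) (denomM s t).
Proof.
rewrite /loc_mul; case: (loc_repr a s) => r; case: (loc_repr b t) => r'.
case: (repr (loc_frac a s)) (repr (loc_frac b t)) => [a' s'] [b' t'] /= h' h.
apply/loc_fracP; exists (denomM r r') => /=.
transitivity (dval r' * b' * dval t * (dval r * (a' * dval s - a * dval s')) +
   dval r * a * dval s' * (dval r' * (b' * dval t - b * dval t'))); first by ring.
by rewrite h h' !mulr0 addr0.
Qed.

Lemma loc_frac_eq a s b t : a * dval t = b * dval s -> loc_frac a s = loc_frac b t.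
Proof. by move=> h; apply/loc_fracP; exists denom1; rewrite h subrr mulr0. Qed.

Lemma loc_addA : associative loc_add.
Proof.
move=> x y z; case: (loc_fracW x) (loc_fracW y) (loc_fracW z)
  => [a [s ->]] [b [t ->]] [c [w ->]].
by rewrite !loc_addE; apply: loc_frac_eq => /=; ring.
Qed.
Lemma loc_addC : commutative loc_add.
Proof.
move=> x y; case: (loc_fracW x) (loc_fracW y) => [a [s ->]] [b [t ->]].
by rewrite !loc_addE; apply: loc_frac_eq => /=; ring.
Qed.
Lemma loc_add0 : left_id (loc_frac 0 denom1) loc_add.
Proof.
move=> x; case: (loc_fracW x) => [a [s ->]].
by rewrite !loc_addE; apply: loc_frac_eq => /=; ring.
Qed.
Lemma loc_addN : left_inverse (loc_frac 0 denom1) loc_opp loc_add.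
Proof.
move=> x; case: (loc_fracW x) => [a [s ->]].
by rewrite loc_oppE loc_addE; apply: loc_frac_eq => /=; ring.
Qed.
HB.instance Definition _ :=
  GRing.isZmodule.Build localization loc_addA loc_addC loc_add0 loc_addN.

Lemma loc_mulA : associative loc_mul.
Proof.
move=> x y z; case: (loc_fracW x) (loc_fracW y) (loc_fracW z)
  => [a [s ->]] [b [t ->]] [c [w ->]].
by rewrite !loc_mulE; apply: loc_frac_eq => /=; ring.
Qed.
Lemma loc_mulC : commutative loc_mul.
Proof.
move=> x y; case: (loc_fracW x) (loc_fracW y) => [a [s ->]] [b [t ->]].
by rewrite !loc_mulE; apply: loc_frac_eq => /=; ring.
Qed.
Lemma loc_mul1 : left_id (loc_frac 1 denom1) loc_mul.
Proof.
move=> x; case: (loc_fracW x) => [a [s ->]].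
by rewrite !loc_mulE; apply: loc_frac_eq => /=; ring.
Qed.
Lemma loc_mulDl : left_distributive loc_mul loc_add.
Proof.
move=> x y z; case: (loc_fracW x) (loc_fracW y) (loc_fracW z)
  => [a [s ->]] [b [t ->]] [c [w ->]].
by rewrite !(loc_mulE, loc_addE); apply: loc_frac_eq => /=; ring.
Qed.
Lemma loc_1neq0 : loc_frac 1 denom1 != 0.
Proof.
apply/eqP => /loc_fracP[r] /=; rewrite mul1r mul0r subr0 mulr1 => r0.
by apply: (@denomP r); rewrite r0; exact: spec0.
Qed.
HB.instance Definition _ := GRing.Zmodule_isComNzRing.Build localization
  loc_mulA loc_mulC loc_mul1 loc_mulDl loc_1neq0.

Lemma loc_fracD a s b t :
  loc_frac a s + loc_frac b t = loc_frac (a * dval t + b * dval s) (denomM s t).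
Proof. exact: loc_addE. Qed.
Lemma loc_fracN a s : - loc_frac a s = loc_frac (- a) s.
Proof. exact: loc_oppE. Qed.
Lemma loc_fracM a s b t :
  loc_frac a s * loc_frac b t = loc_frac (a * b) (denomM s t).
Proof. exact: loc_mulE. Qed.

Definition to_loc (a : A) : localization := loc_frac a denom1.

Lemma to_loc_is_zmod_morphism : zmod_morphism to_loc.
Proof.
move=> a b; rewrite /to_loc loc_fracN loc_fracD.
by apply: loc_frac_eq => /=; ring.
Qed.
Lemma to_loc_is_monoid_morphism : monoid_morphism to_loc.
Proof.
split=> // a b; rewrite /to_loc loc_fracM.
by apply: loc_frac_eq => /=; ring.
Qed.
HB.instance Definition _ := GRing.isZmodMorphism.Build A localization to_loc
  to_loc_is_zmod_morphism.
HB.instance Definition _ := GRing.isMonoidMorphism.Build A localization to_loc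
  to_loc_is_monoid_morphism.

(* The ideal P A_P generated by the image of P in A_P. *)
Definition loc_ideal : pred localization := fun z =>
  `[< exists n (c : 'I_n -> localization) (p : 'I_n -> A),
        (forall i, P (p i)) /\ z = \sum_(i < n) c i * to_loc (p i) >].

Lemma loc_idealP z :
  reflect (exists p s, P p /\ z = loc_frac p s) (loc_ideal z).
Proof.
apply: (iffP (asboolP _)) => [[n [c [p [hp ->]]]]|[p [s [hp ->]]]].
  elim/big_ind: _ => [|x y [a [s [ha ->]]] [b [t [hb ->]]]|i _].
  - by exists 0, denom1; split=> //; exact: spec0.
  - exists (a * dval t + b * dval s), (denomM s t).
    rewrite -loc_fracD; split=> //.
    by apply: specD; rewrite mulrC; apply: specMl.
  - case: (loc_fracW (c i)) => a [s ->]; exists (a * p i), (denomM s denom1).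
    by split; [apply: specMl | rewrite -loc_fracM].
exists 1%N, (fun _ => loc_frac 1 s), (fun _ => p); split=> //.
rewrite big_ord1 /to_loc loc_fracM.
by apply: loc_frac_eq => /=; ring.
Qed.

Lemma loc_ideal_closed : idealr_closed loc_ideal.
Proof.
split.
- by apply/loc_idealP; exists 0, denom1; split=> //; exact: spec0.
- apply/negP => /loc_idealP[p [s [hp /loc_fracP[r] /=]]].
  rewrite mul1r mulr1 mulrBr => /eqP; rewrite subr_eq0 => /eqP h.
  by apply: (@denomP (denomM r s)); rewrite /= h; apply: specMl.
move=> a _ _ /loc_idealP[p [s [hp ->]]] /loc_idealP[q [t [hq ->]]].
case: (loc_fracW a) => {}a [w ->]; apply/loc_idealP.
exists (a * p * dval t + q * dval (denomM w s)), (denomM (denomM w s) t).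
rewrite -loc_fracD -loc_fracM; split=> //.
apply: specD; first by rewrite mulrC; do 2! apply: specMl.
by rewrite mulrC; apply: specMl.
Qed.
HB.instance Definition _ := isIdealr.Build localization loc_ideal loc_ideal_closed.

Definition loc_max : idealr localization := loc_ideal.
Definition residue_field := {ideal_quot loc_max}.
HB.instance Definition _ := GRing.ComNzRing.on residue_field.

Definition to_residue (a : A) : residue_field :=
  \pi_residue_field (to_loc a).

Lemma to_residue_is_zmod_morphism : zmod_morphism to_residue.
Proof. by move=> a b; rewrite /to_residue !rmorphB. Qed.
Lemma to_residue_is_monoid_morphism : monoid_morphism to_residue.
Proof. by split=> [|a b]; rewrite /to_residue ?rmorph1 ?rmorphM. Qed.
HB.instance Definition _ := GRing.isZmodMorphism.Build A residue_field to_residue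
  to_residue_is_zmod_morphism.
HB.instance Definition _ := GRing.isMonoidMorphism.Build A residue_field to_residue
  to_residue_is_monoid_morphism.

Lemma residue_field_inv (x : residue_field) : x != 0 -> exists y, x * y = 1.
Proof.
rewrite -[x]reprK; case: (loc_fracW (repr x)) => a [s ->] nz.
have Pa : ~ P a.
  move=> Pa; case/negP: nz; rewrite -(rmorph0 \pi_residue_field).
  rewrite eqmodE /= Quotient.equivE subr0.
  by apply/loc_idealP; exists a, s.
exists (\pi_residue_field (loc_frac (dval s) (Denom Pa))).
rewrite -rmorphM loc_fracM -(rmorph1 \pi_residue_field); congr (\pi_residue_field _).
by apply: loc_frac_eq => /=; ring.
Qed.

End Localization.

(* The tensor product K (x)_A B of two A-algebras.  A list
   [:: (k_1, b_1); ...; (k_n, b_n)] stands for the sum of the k_i (x) b_i;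
   [tensor_cong] is the congruence generated by the tensor relations and
   commutativity of the sum.  Inverses come for free from
   - (k (x) b) = (- k) (x) b. *)
Inductive tensor_cong (A K B : comPzRingType)
    (f : {rmorphism A -> K}) (g : {rmorphism A -> B}) :
    seq (K * B) -> seq (K * B) -> Prop :=
| tc_refl s : tensor_cong f g s s
| tc_sym s t : tensor_cong f g s t -> tensor_cong f g t s
| tc_trans s t w :
    tensor_cong f g s t -> tensor_cong f g t w -> tensor_cong f g s w
| tc_cat s s' t t' : tensor_cong f g s s' -> tensor_cong f g t t' ->
    tensor_cong f g (s ++ t) (s' ++ t')
| tc_catC s t : tensor_cong f g (s ++ t) (t ++ s)
| tc_addl k k' b : tensor_cong f g [:: (k + k', b)] [:: (k, b); (k', b)]
| tc_addr k b b' : tensor_cong f g [:: (k, b + b')] [:: (k, b); (k, b')]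
| tc_zero b : tensor_cong f g [:: (0, b)] [::]
| tc_bal a k b : tensor_cong f g [:: (k * f a, b)] [:: (k, g a * b)].

Section Tensor.
Variables (A K B : comPzRingType) (f : {rmorphism A -> K}) (g : {rmorphism A -> B}).

Local Notation tc := (tensor_cong f g).

Definition tensor_equiv (s t : seq (K * B)) : bool := `[< tc s t >].

Lemma tensor_equiv_is_equiv : equiv_class_of tensor_equiv.
Proof.
split=> [s|s t|t s w].
- by apply/asboolP; exact: tc_refl.
- by apply/asboolP/asboolP; exact: tc_sym.
- by move=> /asboolP h /asboolP h'; apply/asboolP; apply: tc_trans h h'.
Qed.

Canonical tensor_equiv_equiv := EquivRelPack tensor_equiv_is_equiv.
Canonical tensor_equiv_encModRel := defaultEncModRel tensor_equiv.

Definition tensor := {eq_quot tensor_equiv}.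
HB.instance Definition _ := EqQuotient.on tensor.
HB.instance Definition _ := Choice.on tensor.

Definition tsum (s : seq (K * B)) : tensor := \pi_tensor s.

Lemma tsumP s t : (tsum s = tsum t) <-> tc s t.
Proof.
split; first by move/eqmodP/asboolP.
by move=> h; apply/eqmodP/asboolP.
Qed.

Lemma tsumW (x : tensor) : exists s, x = tsum s.
Proof. by exists (repr x); rewrite /tsum reprK. Qed.

Lemma tc_repr s : tc (repr (tsum s)) s.
Proof. by apply/tsumP; rewrite /tsum reprK. Qed.

Definition sopp (s : seq (K * B)) := [seq (- x.1, x.2) | x <- s].
Definition smul (s t : seq (K * B)) :=
  [seq (x.1 * y.1, x.2 * y.2) | x <- s, y <- t].

Definition tensor_add (x y : tensor) : tensor := tsum (repr x ++ repr y).
Definition tensor_opp (x : tensor) : tensor := tsum (sopp (repr x)).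
Definition tensor_mul (x y : tensor) : tensor := tsum (smul (repr x) (repr y)).

Lemma tc_cons x s t : tc s t -> tc (x :: s) (x :: t).
Proof. by move=> h; apply: (@tc_cat _ _ _ _ _ [:: x] [:: x]) => //; exact: tc_refl. Qed.

Lemma tc_perm s t : perm_eq s t -> tc s t.
Proof.
elim: s t => [|x s IHs] t.
  by rewrite perm_sym => /perm_nilP->; exact: tc_refl.
move=> hp; have xt : x \in t by rewrite -(perm_mem hp) mem_head.
case/splitPr: xt hp => t1 t2 hp.
apply: (@tc_trans _ _ _ _ _ _ (x :: t2 ++ t1)); last exact: (@tc_catC _ _ _ _ _ (x :: t2)).
apply: tc_cons; apply: IHs.
by move: hp; rewrite perm_sym perm_catC /= perm_cons perm_sym.
Qed.

Lemma sopp_cong s t : tc s t -> tc (sopp s) (sopp t).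
Proof.
elim=> {s t} [s|s t _ h|s t w _ h _ h'|s s' t t' _ h _ h'|s t|k k' b|k b b'|b|a k b] /=.
- exact: tc_refl.
- exact: tc_sym.
- exact: tc_trans h h'.
- by rewrite /sopp !map_cat; exact: tc_cat.
- by rewrite /sopp !map_cat; exact: tc_catC.
- by rewrite opprD; exact: tc_addl.
- exact: tc_addr.
- by rewrite oppr0; exact: tc_zero.
- by rewrite -mulNr; exact: tc_bal.
Qed.

Lemma smul_consl x s t :
  smul (x :: s) t = [seq (x.1 * y.1, x.2 * y.2) | y <- t] ++ smul s t.
Proof. by []. Qed.

Lemma smul_catl s s' t : smul (s ++ s') t = smul s t ++ smul s' t.
Proof. exact: allpairs_cat. Qed.

Lemma smul_consr s y t :
  perm_eq (smul s (y :: t)) ([seq (x.1 * y.1, x.2 * y.2) | x <- s] ++ smul s t).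
Proof. exact/permPl/perm_allpairs_consr. Qed.

Lemma smulC s t : perm_eq (smul s t) (smul t s).
Proof.
elim: s => [|x s IHs]; first by rewrite /smul allpairs0r.
rewrite perm_sym (perm_trans (smul_consr _ _ _)) // smul_consl.
have -> : [seq (y.1 * x.1, y.2 * x.2) | y <- t]
        = [seq (x.1 * y.1, x.2 * y.2) | y <- t] :> seq (K * B).
  by apply: eq_map => y; rewrite [x.1 * _]mulrC [x.2 * _]mulrC.
by rewrite perm_cat2l perm_sym.
Qed.

Lemma smul1_cong y s t : tc s t ->
  tc [seq (x.1 * y.1, x.2 * y.2) | x <- s] [seq (x.1 * y.1, x.2 * y.2) | x <- t].
Proof.
elim=> {s t} [s|s t _ h|s t w _ h _ h'|s s' t t' _ h _ h'|s t|k k' b|k b b'|b|a k b] /=.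
- exact: tc_refl.
- exact: tc_sym.
- exact: tc_trans h h'.
- by rewrite !map_cat; exact: tc_cat.
- by rewrite !map_cat; exact: tc_catC.
- by rewrite mulrDl; exact: tc_addl.
- by rewrite mulrDl; exact: tc_addr.
- by rewrite mul0r; exact: tc_zero.
- by rewrite mulrAC -[g a * b * _]mulrA; exact: tc_bal.
Qed.

Lemma smul_congl s s' t : tc s s' -> tc (smul s t) (smul s' t).
Proof.
move=> h; elim: t => [|y t IHt]; first by rewrite /smul !allpairs0r; exact: tc_refl.
apply: tc_trans (tc_perm (smul_consr _ _ _)) _.
apply: tc_trans _ (tc_sym (tc_perm (smul_consr _ _ _))).
by apply: tc_cat => //; exact: smul1_cong.
Qed.

Lemma smul_cong s s' t t' : tc s s' -> tc t t' -> tc (smul s t) (smul s' t').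
Proof.
move=> hs ht; apply: tc_trans (smul_congl t hs) _.
apply: tc_trans (tc_perm (smulC _ _)) _.
by apply: tc_trans (smul_congl s' ht) (tc_perm (smulC _ _)).
Qed.

Lemma tensor_addE s t : tensor_add (tsum s) (tsum t) = tsum (s ++ t).
Proof. by apply/tsumP; apply: tc_cat; exact: tc_repr. Qed.
Lemma tensor_oppE s : tensor_opp (tsum s) = tsum (sopp s).
Proof. by apply/tsumP; apply: sopp_cong; exact: tc_repr. Qed.
Lemma tensor_mulE s t : tensor_mul (tsum s) (tsum t) = tsum (smul s t).
Proof. by apply/tsumP; apply: smul_cong; exact: tc_repr. Qed.

Lemma tensor_addA : associative tensor_add.
Proof.
move=> x y z; case: (tsumW x) (tsumW y) (tsumW z) => s -> [t ->] [w ->].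
by rewrite !tensor_addE catA.
Qed.
Lemma tensor_addC : commutative tensor_add.
Proof.
move=> x y; case: (tsumW x) (tsumW y) => s -> [t ->].
by rewrite !tensor_addE; apply/tsumP; exact: tc_catC.
Qed.
Lemma tensor_add0 : left_id (tsum [::]) tensor_add.
Proof. by move=> x; case: (tsumW x) => s ->; rewrite tensor_addE. Qed.
Lemma tensor_addN : left_inverse (tsum [::]) tensor_opp tensor_add.
Proof.
move=> x; case: (tsumW x) => s ->; rewrite tensor_oppE tensor_addE; apply/tsumP.
elim: s => [|[k b] s IHs]; first exact: tc_refl.
apply: (@tc_trans _ _ _ _ _ _ ([:: (- k, b); (k, b)] ++ (sopp s ++ s))).
  apply: tc_perm; rewrite /= perm_cons.
  exact/permPl/(perm_catCA (sopp s) [:: (k, b)] s).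
apply: (@tc_cat _ _ _ _ _ _ [::] _ [::]) => //.
apply: tc_trans (tc_sym (tc_addl _ _ _ _ _)) _.
by rewrite addNr; exact: tc_zero.
Qed.
HB.instance Definition _ :=
  GRing.isZmodule.Build tensor tensor_addA tensor_addC tensor_add0 tensor_addN.

Lemma tensor_mulA : associative tensor_mul.
Proof.
move=> x y z; case: (tsumW x) (tsumW y) (tsumW z) => s -> [t ->] [w ->].
rewrite !tensor_mulE; congr tsum.
elim: s => // x0 s IHs; rewrite !smul_consl smul_catl IHs; congr (_ ++ _).
elim: t {IHs} => // y0 t IHt; rewrite smul_consl map_cat IHt /= smul_consl.
by congr (_ ++ _); rewrite -map_comp; apply: eq_map => z0 /=; rewrite !mulrA.
Qed.
Lemma tensor_mulC : commutative tensor_mul.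
Proof.
move=> x y; case: (tsumW x) (tsumW y) => s -> [t ->].
by rewrite !tensor_mulE; apply/tsumP; apply: tc_perm; exact: smulC.
Qed.
Lemma tensor_mul1 : left_id (tsum [:: (1, 1)]) tensor_mul.
Proof.
move=> x; case: (tsumW x) => s ->; rewrite tensor_mulE smul_consl cats0.
by congr tsum; rewrite -[RHS]map_id; apply: eq_map => -[k b] /=; rewrite !mul1r.
Qed.
Lemma tensor_mulDl : left_distributive tensor_mul tensor_add.
Proof.
move=> x y z; case: (tsumW x) (tsumW y) (tsumW z) => s -> [t ->] [w ->].
by rewrite !(tensor_mulE, tensor_addE) smul_catl.
Qed.
HB.instance Definition _ := GRing.Zmodule_isComPzRing.Build tensor
  tensor_mulA tensor_mulC tensor_mul1 tensor_mulDl.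

Definition pure_tensor (k : K) (b : B) : tensor := tsum [:: (k, b)].

Lemma tsumE s : tsum s = \sum_(x <- s) pure_tensor x.1 x.2.
Proof.
elim: s => [|[k b] s IHs]; first by rewrite big_nil.
by rewrite big_cons -IHs [RHS]tensor_addE.
Qed.

Lemma pure_tensorDl k k' b :
  pure_tensor (k + k') b = pure_tensor k b + pure_tensor k' b.
Proof. by rewrite [RHS]tensor_addE; apply/tsumP; exact: tc_addl. Qed.
Lemma pure_tensorDr k b b' :
  pure_tensor k (b + b') = pure_tensor k b + pure_tensor k b'.
Proof. by rewrite [RHS]tensor_addE; apply/tsumP; exact: tc_addr. Qed.
Lemma pure_tensorNl k b : pure_tensor (- k) b = - pure_tensor k b.
Proof. by rewrite [RHS]tensor_oppE. Qed.
Lemma pure_tensor_bal a k b : pure_tensor (k * f a) b = pure_tensor k (g a * b).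
Proof. by apply/tsumP; exact: tc_bal. Qed.
Lemma pure_tensorM k b k' b' :
  pure_tensor k b * pure_tensor k' b' = pure_tensor (k * k') (b * b').
Proof. exact: tensor_mulE. Qed.

(* A ring morphism (instances below), so it is an isomorphism of rings as soon
   as it is bijective. *)
Definition tensor_inl (k : K) : tensor := pure_tensor k 1.

Lemma tensor_inl_is_zmod_morphism : zmod_morphism tensor_inl.
Proof. by move=> k k'; rewrite /tensor_inl pure_tensorDl pure_tensorNl. Qed.
Lemma tensor_inl_is_monoid_morphism : monoid_morphism tensor_inl.
Proof. by split=> // k k'; rewrite /tensor_inl pure_tensorM mulr1. Qed.
HB.instance Definition _ := GRing.isZmodMorphism.Build K tensor tensor_inl
  tensor_inl_is_zmod_morphism.
HB.instance Definition _ := GRing.isMonoidMorphism.Build K tensor tensor_inl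
  tensor_inl_is_monoid_morphism.

(* The universal property: balanced biadditive maps factor through [tensor]. *)
Lemma tensor_lift (V : zmodType) (h : K -> B -> V) :
  (forall k k' b, h (k + k') b = h k b + h k' b) ->
  (forall k b b', h k (b + b') = h k b + h k b') ->
  (forall a k b, h (k * f a) b = h k (g a * b)) ->
  exists H : {additive tensor -> V}, forall k b, H (pure_tensor k b) = h k b.
Proof.
move=> hDl hDr hbal.
pose E (s : seq (K * B)) := \sum_(x <- s) h x.1 x.2.
have Ecat s t : E (s ++ t) = E s + E t by rewrite /E big_cat.
have Etc s t : tc s t -> E s = E t.
  elim=> {s t} [s|s t _ h0|s t w _ h0 _ h'|s s' t t' _ h0 _ h'|s t|k k' b|k b b'|b|a k b] //.
  - by rewrite h0.
  - by rewrite !Ecat h0 h'.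
  - by rewrite !Ecat addrC.
  - by rewrite /E !big_cons !big_nil !addr0 /= hDl.
  - by rewrite /E !big_cons !big_nil !addr0 /= hDr.
  - rewrite /E big_cons !big_nil addr0 /=.
    by apply: (addrI (h 0 b)); rewrite -hDl !addr0.
  - by rewrite /E !big_cons !big_nil !addr0 /= hbal.
pose H (x : tensor) := E (repr x).
have HE s : H (tsum s) = E s by apply: Etc; exact: tc_repr.
have HD x y : H (x + y) = H x + H y.
  case: (tsumW x) (tsumW y) => s -> [t ->].
  by rewrite [_ + _ in LHS]tensor_addE !HE Ecat.
have HB : zmod_morphism H.
  by move=> x y; apply: (addIr (H y)); rewrite -HD !subrK.
pose HM := GRing.isZmodMorphism.Build tensor V H HB.
pose HA : {additive tensor -> V} := HB.pack H HM.
by exists HA => k b; rewrite /= HE /E big_cons big_nil addr0.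
Qed.

End Tensor.

Definition finite_morphism (A B : comPzRingType) (u : {rmorphism A -> B}) : Prop :=
  exists n (e : 'I_n -> B), forall b, exists c : 'I_n -> A,
    b = \sum_(i < n) u (c i) * e i.

Definition strong_PSI (A B : comPzRingType) (u : {rmorphism A -> B}) : Prop :=
  forall P : spec A,
    let T := tensor (@to_residue A P) u in
    (exists x : T, x != 0) ->
    bijective (tensor_inl (@to_residue A P) u).

(* Main.v *)
Require Import Defs.
From HB Require Import structures.
From mathcomp Require Import all_boot all_algebra.
From mathcomp Require Import boolp classical_sets.
From mathcomp Require Import ring.

Set Implicit Arguments.
Unset Strict Implicit.
Unset Printing Implicit Defensive.

Import GRing.Theory.
Local Open Scope ring_scope.
Local Open Scope quotient_scope.

(** Suppose some [b] is not in [u(A)].  The elements [s] of [A] such that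
    [u s * b] lies in [u(A)] form a proper ideal [I], contained in a maximal
    ideal [m] ([exists_maximal_spec]).

    Since [k(m)] is [A / m] ([to_residue_surj]), the tensor product of [k(m)]
    and [B] over [A] is [B / mB].  The morphism from [k(m)] to it is surjective:
    by the strong PSI hypothesis if the target is nonzero, trivially otherwise
    ([strong_PSI_tensor_inl_surj]).  Hence [B = u(A) + mB]
    ([tensor_inl_surj_subgroup]).

    As [B] is a finite [A]-module, Nakayama's lemma for [B / u(A)] now gives
    [s] in [1 + m] with [s B] inside [u(A)] ([nakayama_image]).  Then [s] is in
    [I], hence in [m], and so is [1]: a contradiction. *)

Lemma specB (A : comPzRingType) (P : spec A) x y : P x -> P y -> P (x - y).
Proof. by move=> Px Py; rewrite -mulN1r; apply/specD/specMl. Qed.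

Definition proper_ideal_set (A : comPzRingType) (I : set A) : Prop :=
  [/\ I 0, forall x y, I x -> I y -> I (x + y),
      forall a x, I x -> I (a * x) & ~ I 1].

(** Maximality as the existence of inverses in [A / P]: the form that turns a
    fraction of [A_P] into an element of [A], up to the ideal [P A_P]. *)
Definition maximal_spec (A : comPzRingType) (P : spec A) : Prop :=
  forall x, ~ P x -> exists y, P (1 - x * y).

(** Krull's theorem: a union of a chain of proper ideals is still proper, as it
    cannot contain 1, so Zorn's lemma applies. *)
Lemma exists_maximal_spec (A : comPzRingType) (I : set A) :
  proper_ideal_set I ->
  exists P : spec A, (forall x, I x -> P x) /\ maximal_spec P.
Proof.
case=> I0 ID IM I1.
(* [Zorn_bigcup] also asks for the union of the empty chain, hence the extra
   disjunct. *)
pose Q : set (set A) := fun X => X = set0 \/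
  proper_ideal_set X /\ (I `<=` X)%classic.
have [F FQ Ftot|M [QM Mmax]] := @Zorn_bigcup A Q.
  have [[X [FX X0]]|noX] := pselect (exists X, F X /\ X 0); last first.
    left; apply/seteqP; split=> // x [X FX Xx].
    case: (FQ _ FX) => [X0|[[X0 _ _ _] _]]; first by rewrite X0 in Xx.
    by apply: noX; exists X.
  have idl Y y : F Y -> Y y -> proper_ideal_set Y /\ (I `<=` Y)%classic.
    by move=> /FQ[->|].
  right; split; last first.
    by move=> x Ix; exists X => //; case: (idl _ _ FX X0) => _; apply.
  split; first by exists X.
  - move=> x y [Y FY Yx] [Z FZ Zy].
    case: (Ftot Y Z FY FZ) => [YZ|ZY].
      by exists Z => //; case: (idl _ _ FZ Zy) => -[_ D _ _] _; apply: D => //; exact: YZ.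
    by exists Y => //; case: (idl _ _ FY Yx) => -[_ D _ _] _; apply: D => //; exact: ZY.
  - move=> a x [Y FY Yx]; exists Y => //.
    by case: (idl _ _ FY Yx) => -[_ _ M _] _; exact: M.
  - by move=> [Y FY Y1]; case: (idl _ _ FY Y1) => -[].
case: QM => [M0|[[M0 MD MM M1] IM']].
  by case: (Mmax I); [rewrite M0; split=> // /(_ 0 I0) | right; split].
(* Otherwise the ideal generated by [M] and [x] would be proper and larger. *)
have Mmax' x : ~ M x -> exists y, M (1 - x * y).
  move=> nMx; apply: contrapT => noy.
  pose J : set A := fun z => exists m y, M m /\ z = m + x * y.
  have MJ z : M z -> J z by move=> Mz; exists z, 0; rewrite mulr0 addr0.
  apply: (Mmax J); first split=> //.
    by move/(_ x) => h; apply/nMx/h; exists 0, 1; rewrite mulr1 add0r.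
  right; split; last by move=> z /IM'; exact: MJ.
  split; first exact: MJ.
  - move=> _ _ [m [y [Mm ->]]] [m' [y' [Mm' ->]]].
    by exists (m + m'), (y + y'); split; [exact: MD | ring].
  - move=> a _ [m [y [Mm ->]]].
    by exists (a * m), (a * y); split; [exact: MM | ring].
  - move=> [m [y [Mm h]]]; apply: noy; exists y.
    by rewrite h addrK.
have Mprime : prime_ideal M.
  split=> // x y Mxy; have [Mx|/Mmax'[z Mz]] := pselect (M x); [by left|right].
  have -> : y = y * (1 - x * z) + z * (x * y) by ring.
  by apply: MD; apply: MM.
by exists (Spec Mprime).
Qed.

(** [A / P] embeds in the residue field: if [a] is [p / s] in [A_P] with [p] in
    [P], some product [r * s * a] with [r], [s] outside [P] lies in [P]. *)
Lemma to_residue_eq0 (A : comPzRingType) (P : spec A) a :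
  to_residue P a = 0 <-> P a.
Proof.
have -> : (to_residue P a = 0) <-> loc_ideal (to_loc P a).
  rewrite /to_residue -(rmorph0 \pi_(residue_field P)).
  split=> [/eqmodP|h]; first by rewrite /= Quotient.equivE subr0.
  by apply/eqmodP; rewrite /= Quotient.equivE subr0.
split=> [/loc_idealP[p [s [Pp /loc_fracP[r]]]]|Pa]; last first.
  by apply/loc_idealP; exists a, (denom1 P).
rewrite /= mulr1 => h.
have : P (dval r * (a * dval s)).
  have -> : dval r * (a * dval s) = dval r * p by apply/eqP; rewrite -subr_eq0 -mulrBr h.
  exact: specMl.
by case/specM=> [/denomP//|/specM[//|/denomP]].
Qed.

(** At a maximal ideal the residue field is [A / P]: the fraction [a / s] has
    the same class as [a * t], where [t] inverts [s] modulo [P]. *)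
Lemma to_residue_surj (A : comPzRingType) (P : spec A) :
  maximal_spec P ->
  forall k : residue_field P, exists a, to_residue P a = k.
Proof.
move=> Pmax k; rewrite -[k]reprK; case: (loc_fracW (repr k)) => a [s ->].
have [t Pt] := Pmax _ (@denomP _ _ s).
exists (a * t); apply/eqmodP; rewrite /= Quotient.equivE.
apply/loc_idealP; exists (- a * (1 - dval s * t)), s; split; first exact: specMl.
rewrite /to_loc loc_fracN loc_fracD; apply: loc_frac_eq => /=; ring.
Qed.

Lemma strong_PSI_tensor_inl_surj (A B : comPzRingType) (u : {rmorphism A -> B})
    (P : spec A) :
  strong_PSI u -> forall t, exists k, tensor_inl (to_residue P) u k = t.
Proof.
move=> uPSI t.
have [[x x0]|T0] := pselect (exists x : tensor (to_residue P) u, x != 0).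
  by have [g _ gK] := uPSI P (ex_intro _ x x0); exists (g t).
have t0 (x : tensor (to_residue P) u) : x = 0.
  by apply: contrapT => /eqP x0; apply: T0; exists x.
by exists 0; rewrite [LHS]t0 [RHS]t0.
Qed.

(** The inclusion of [B] in [u(A) + PB], tested on an arbitrary additive subgroup
    [S] containing [u(A)] and [PB].  Since [k(P) = A / P], the group [B / S]
    receives an additive map from the tensor product, sending the class of [a]
    tensored with [c] to the class of [u a * c].  It kills the image of [k(P)]
    because [S] contains [u(A)], hence it is zero. *)
Lemma tensor_inl_surj_subgroup (A B : comPzRingType) (u : {rmorphism A -> B})
    (P : spec A) (S : zmodClosed B) :
  maximal_spec P ->
  (forall t, exists k, tensor_inl (to_residue P) u k = t) ->
  (forall a, u a \in S) -> (forall p b, P p -> u p * b \in S) ->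
  forall b, b \in S.
Proof.
move=> Pmax inl_surj uS PS b.
pose pi : {additive B -> Quotient.quot S} := \pi_(Quotient.quot S).
have pi_eq0 c : (pi c = 0) <-> (c \in S).
  rewrite -(raddf0 pi); split=> [/eqmodP|cS]; first by rewrite /= Quotient.equivE subr0.
  by apply/eqmodP; rewrite /= Quotient.equivE subr0.
have [l lK] := choice (to_residue_surj Pmax).
have piE a a' c : to_residue P a = to_residue P a' ->
    pi (u a * c) = pi (u a' * c).
  move=> eq_aa'; apply/eqP; rewrite -subr_eq0 -raddfB -mulrBl -rmorphB.
  by apply/eqP/pi_eq0/PS/to_residue_eq0; rewrite rmorphB /= eq_aa' subrr.
pose h (k : residue_field P) c := pi (u (l k) * c).
have [|||H HE] := @tensor_lift _ _ _ (to_residue P) u (Quotient.quot S) h.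
- move=> k k' c; rewrite /h -raddfD -mulrDl -rmorphD; apply: piE.
  by rewrite rmorphD /= !lK.
- by move=> k c c'; rewrite /h -raddfD -mulrDr.
- move=> a k c; rewrite /h mulrA -rmorphM; apply: piE.
  by rewrite rmorphM /= !lK.
have H0 t : H t = 0.
  by have [k <-] := inl_surj t; rewrite HE /h mulr1; apply/pi_eq0.
apply/pi_eq0; rewrite -(H0 (pure_tensor _ _ 1 b)) HE /h (piE _ 1) ?lK ?rmorph1 //.
by rewrite mul1r.
Qed.

Section ImagePlus.
Variables (A B : comPzRingType) (u : {rmorphism A -> B}) (P : spec A).
Variables (n : nat) (e : 'I_n -> B).

(** When [e] generates the [A]-module [B], this is [u(A) + PB]; coefficients on
    the generators themselves are what the determinant argument below needs. *)
Definition image_plus : {pred B} := fun b =>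
  `[< exists a (m : 'I_n -> A), (forall i, P (m i)) /\
        b = u a + \sum_(i < n) u (m i) * e i >].

Lemma image_plus_closed : zmod_closed image_plus.
Proof.
split.
  apply/asboolP; exists 0, (fun=> 0); split=> [i|]; first exact: spec0.
  by rewrite rmorph0 add0r big1 // => i _; rewrite mul0r.
move=> _ _ /asboolP[a [m [Pm ->]]] /asboolP[a' [m' [Pm' ->]]].
apply/asboolP; exists (a - a'), (fun i => m i - m' i); split=> [i|].
  exact: specB.
rewrite rmorphB opprD addrACA -sumrB; congr (_ + _).
by apply: eq_bigr => i _; rewrite rmorphB mulrBl.
Qed.
HB.instance Definition _ := GRing.isZmodClosed.Build B image_plus image_plus_closed.

(** The determinant form of Nakayama's lemma for [B / u(A)].  Modulo [u(A)] the
    column [e] is killed by a matrix [1 - M] with [M] over [P]; multiplying by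
    the adjugate shows that [s = det (1 - M)] kills it too, and [s] is 1 modulo
    [P]. *)
Lemma nakayama_image : (forall i, e i \in image_plus) ->
  exists s, P (1 - s) /\ forall i, exists a, u s * e i = u a.
Proof.
move=> eN.
have /choice[a /choice[m am]] : forall i, exists a (m : 'I_n -> A),
    (forall j, P (m j)) /\ e i = u a + \sum_(j < n) u (m j) * e j.
  by move=> i; apply/asboolP/eN.
pose D : 'M[A]_n := 1%:M - \matrix_(i, j) m i j.
pose E : 'cV[B]_n := \col_i e i.
pose a_ : 'cV[A]_n := \col_i a i.
have DE : map_mx u D *m E = map_mx u a_.
  rewrite map_mxB map_mx1 mulmxBl mul1mx; apply/colP => i.
  rewrite !mxE [in e i](am i).2; apply/eqP; rewrite subr_eq; apply/eqP.
  by congr (_ + _); apply: eq_bigr => j _; rewrite !mxE.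
exists (\det D); split=> [|i].
  apply/to_residue_eq0; rewrite rmorphB rmorph1 -det_map_mx.
  rewrite map_mxB map_mx1 [map_mx _ (\matrix_(i, j) _)](_ : _ = 0).
    by rewrite subr0 det1 subrr.
  by apply/matrixP => i j; rewrite !mxE; apply/to_residue_eq0/(am i).1.
exists ((\adj D *m a_) i 0).
have /colP/(_ i) : u (\det D) *: E = map_mx u (\adj D *m a_).
  by rewrite map_mxM -DE mulmxA map_mx_adj mul_adj_mx det_map_mx mul_scalar_mx.
by rewrite !mxE.
Qed.

End ImagePlus.

Theorem corollary3p8 (A B : comPzRingType) (u : {rmorphism A -> B}) :
  finite_morphism u -> strong_PSI u -> forall b : B, exists a : A, u a = b.
Proof.
move=> [n [e eB]] uPSI b; apply: contrapT => nb.
pose I : set A := fun s => exists a, u a = u s * b.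
have [|P [IP Pmax]] := @exists_maximal_spec A I.
  split.
  - by exists 0; rewrite /= rmorph0 mul0r.
  - by move=> x y [a ha] [a' ha']; exists (a + a'); rewrite !rmorphD ha ha' mulrDl.
  - by move=> c x [a ha]; exists (c * a); rewrite !rmorphM ha mulrA.
  - by case=> a ha; apply: nb; exists a; rewrite ha rmorph1 mul1r.
(* [e] lies in [image_plus] because that subgroup contains [u(A)] and [PB]. *)
have [|s [Ps se]] := @nakayama_image A B u P n e.
  move=> i; apply: (tensor_inl_surj_subgroup Pmax
    (strong_PSI_tensor_inl_surj uPSI)) => [a|p c Pp].
    apply/asboolP; exists a, (fun=> 0); split=> [j|]; first exact: spec0.
    by rewrite big1 ?addr0 // => j _; rewrite /= rmorph0 mul0r.
  have [d ->] := eB c.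
  apply/asboolP; exists 0, (fun j => p * d j); split=> [j|].
    by rewrite mulrC; exact: specMl.
  rewrite rmorph0 add0r mulr_sumr.
  by apply: eq_bigr => j _; rewrite rmorphM mulrA.
have [a_ ha] := choice se.
(* It remains to see that [s] is in [I]: expand [b] on the generators [e]. *)
apply: (@spec1 A P); rewrite -[1](subrK s); apply: specD => //; apply: IP.
rewrite /I; have [c ->] := eB b.
exists (\sum_(i < n) c i * a_ i).
rewrite rmorph_sum mulr_sumr; apply: eq_bigr => i _.
by rewrite rmorphM -ha mulrCA.
Qed.
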